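(* Let $M$ be a generalized Laplacian on a graph $G$ with eigenvalues $\lambda_1\le\lambda_2\le\cdots\le\lambda_n$ (listed with multiplicity, $n=|V_G|$). Let $\lambda_k$ be an eigenvalue of multiplicity $m$, in the sense that $$\lambda_{k-1}<\lambda_k=\lambda_{k+1}=\cdots=\lambda_{k+m-1}<\lambda_{k+m}.$$ Then there exists an orthonormal eigenbasis $\mathbf f_k,\mathbf f_{k+1},\ldots,\mathbf f_{k+m-1}$ of the eigenspace $E(M,\lambda_k)=\ker(M-\lambda_k I)$ such that $$\text{for all } 0\le j\le m-1,\qquad \mathrm{UN}(\mathbf f_{k+j})\le k+\min(j,\,m-1-j).$$
   Context: Graphs $G=(V_G,E_G)$ are finite and simple. A generalized Laplacian on $G$ is a symmetric real matrix $M\in\mathbb R^{V_G\times V_G}$ such that $M(u,v)=0$ whenever $u\ne v$ and $\{u,v\}\notin E_G$, and $M(u,v)<0$ for all $\{u,v\}\in E_G$. In the chain of inequalities defining multiplicity, the inequality involving $\lambda_{k-1}$ is omitted if $k=1$ and the one involving $\lambda_{k+m}$ is omitted if $k+m>n$. For $\mathbf f:V_G\to\mathbb R$, a strong nodal domain of $\mathbf f$ is a connected component of the subgraph of $G$ induced on $\{v:\mathbf f(v)>0\}$ or of the subgraph induced on $\{v:\mathbf f(v)<0\}$; $\mathrm{SND}(\mathbf f)$ is the number of strong nodal domains. A signing of $\mathbf f$ is a nowhere-zero function $\tilde{\mathbf f}:V_G\to\mathbb R$ with $\tilde{\mathbf f}(v)>0$ whenever $\mathbf f(v)>0$ and $\tilde{\mathbf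 f}(v)<0$ whenever $\mathbf f(v)<0$. The Urschel number of $\mathbf f$ is $\mathrm{UN}(\mathbf f)=\min\{\mathrm{SND}(\tilde{\mathbf f}):\tilde{\mathbf f}\text{ is a signing of }\mathbf f\}$.
   Formalization: The formal theorem assumes in addition that G is connected; without this the claim is false: for two isolated vertices and M = 0 (k = 1, m = 2) every f has UN(f) = 2 while the bound is 1, and k = 1, j = 0 fails on every disconnected graph. *)

(* Defs.v *)
From HB Require Import structures.
From mathcomp Require Import all_boot all_order all_algebra.
From mathcomp Require Import boolp reals.

Set Implicit Arguments.
Unset Strict Implicit.
Unset Printing Implicit Defensive.

Import Order.TTheory GRing.Theory Num.Theory.

Local Open Scope ring_scope.

Definition simple_graph (V : finType) (e : rel V) : Prop :=
  symmetric e /\ irreflexive e.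

(* Connectedness cannot be dropped from the theorem: for two isolated vertices
   and M = 0 (k = 1, m = 2) every signing has two strong nodal domains, whereas
   the bound is 1. *)
Definition connected_graph (V : finType) (e : rel V) : Prop :=
  forall u v, connect e u v.

Definition generalized_laplacian (R : realType) (n : nat) (e : rel 'I_n)
    (M : 'M[R]_n) : Prop :=
  [/\ M^T = M,
      forall u v, u != v -> ~~ e u v -> M u v = 0 &
      forall u v, e u v -> M u v < 0].

(* The eigenvalues are [lam 1], ..., [lam n]; other values of [lam] are
   irrelevant. *)
Definition ordered_spectrum (R : realType) (n : nat) (M : 'M[R]_n)
    (lam : nat -> R) : Prop :=
  char_poly M = \prod_(1 <= i < n.+1) ('X - (lam i)%:P) /\
  (forall i j, (1 <= i)%N -> (i <= j)%N -> (j <= n)%N -> lam i <= lam j).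

Definition eigenvalue_block (R : realType) (n : nat) (lam : nat -> R)
    (k m : nat) : Prop :=
  [/\ [&& 1 <= k, 1 <= m & k + m - 1 <= n]%N,
      (1 < k)%N -> lam (k - 1)%N < lam k,
      forall j, (j < m)%N -> lam (k + j)%N = lam k &
      (k + m <= n)%N -> lam (k + m - 1)%N < lam (k + m)%N].

Section NodalDomains.

Variables (R : realType) (V : finType) (e : rel V).
Implicit Types (A : {set V}) (f g : V -> R).

Definition induced_edge A : rel V :=
  [rel u v | [&& u \in A, v \in A & e u v]].

Definition components A : {set {set V}} :=
  [set [set w | connect (induced_edge A) v w] | v in A].

Definition strong_nodal_domains f : {set {set V}} :=
  components [set v | 0 < f v] :|: components [set v | f v < 0].

Definition SND f : nat := #|strong_nodal_domains f|.

Definition signing f g : Prop :=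
  [/\ forall v, g v != 0,
      forall v, 0 < f v -> 0 < g v &
      forall v, f v < 0 -> g v < 0].

Definition SND_of_signing f : pred nat :=
  fun s => `[< exists g, signing f g /\ SND g = s >].

Lemma SND_of_signing_ex f : exists s, SND_of_signing f s.
Proof.
pose g v := if f v < 0 then -1 else 1 : R.
exists (SND g); apply/asboolP; exists g; split=> //; split=> v; rewrite /g.
- by case: ifP; rewrite ?oppr_eq0 oner_eq0.
- by move=> f_gt0; rewrite [f v < 0]ltNge (ltW f_gt0) ltr01.
- by move=> ->; rewrite oppr_lt0 ltr01.
Qed.

Definition UN f : nat := ex_minn (SND_of_signing_ex f).

End NodalDomains.

(* The basis vectors are the rows of [F], and [E] stands for its row space.
   The library's [eigenspace M a] is the space of row vectors [u] with
   [u *m M = a *: u]; for symmetric [M] these are exactly the transposes of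
   the vectors of ker (M - a I). *)
Definition orthonormal_basis (R : realType) (m n p : nat) (F : 'M[R]_(m, n))
    (E : 'M[R]_(p, n)) : Prop :=
  [/\ forall i j, \sum_(v < n) F i v * F j v = (i == j)%:R,
      row_free F & (F == E)%MS].

(* Main.v *)
Require Import Defs.
From HB Require Import structures.
From mathcomp Require Import all_boot all_order all_algebra.
From mathcomp Require Import boolp reals.
From mathcomp Require Import perm spectral zify ring lra.
From mathcomp Require complex.

Set Implicit Arguments.
Unset Strict Implicit.
Unset Printing Implicit Defensive.

Import Order.TTheory GRing.Theory Num.Theory.

Local Open Scope ring_scope.

(* Put [A = M - lam k] and [E = ker A]. If [g] is nowhere zero and
   [g (A + D) = 0] with [D] diagonal, the vectors constant multiples of [g] on
   each strong nodal domain span a space of dimension [SND g] on which the form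
   [A + D] is nonpositive, so [SND g] is at most the codimension of any space
   on which [A + D] is positive definite.

   Choose a diagonal matrix [D0] whose compression to [E] has distinct
   eigenvalues [d 0 < ... < d (m - 1)], with orthonormal eigenvectors [f j].
   To first order, the [n - k - m + 1] eigenvectors of [M] above [lam k] and the
   [f i] with [d i > d j] span a positive space for [A + t (D0 - d j)], [t > 0],
   and [f j] extends to a null vector; this bounds the Urschel number by [k + j].
   Replacing [D0] by [- D0] gives [k + (m - 1 - j)] for the same vector [f j].

   The zeros [Z] of [f j] are dealt with by adding a diagonal term [c > 0] on [Z]
   so small that [ker (A + c 1_Z)] is contained in [E]. Then
   [h (A + c 1_Z) = - (D0 - d j) f j] is solvable, and [f j + t h] is an exact
   null vector of [A + D] with [D] equal to [c] on [Z] and close to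
   [t (D0 - d j)] elsewhere. Zeros that remain can all be made positive. *)

(** * Real symmetric matrices *)

Section DotProduct.

Variables (R : realFieldType) (n : nat).
Implicit Types (x y : 'rV[R]_n).

Definition dotv x y : R := \sum_v x 0 v * y 0 v.

Lemma dotvE x y : dotv x y = (x *m y^T) 0 0.
Proof. by rewrite mxE; apply: eq_bigr => v _; rewrite mxE. Qed.

Lemma dotvC x y : dotv x y = dotv y x.
Proof. by apply: eq_bigr => v _; rewrite mulrC. Qed.

Lemma dotvDl x y z : dotv (x + y) z = dotv x z + dotv y z.
Proof. by rewrite !dotvE mulmxDl mxE. Qed.

Lemma dotvZl a x y : dotv (a *: x) y = a * dotv x y.
Proof. by rewrite !dotvE -scalemxAl mxE. Qed.

Lemma dotvBl x y z : dotv (x - y) z = dotv x z - dotv y z.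
Proof. by rewrite -scaleN1r dotvDl dotvZl mulN1r. Qed.

Lemma dotvDr x y z : dotv z (x + y) = dotv z x + dotv z y.
Proof. by rewrite dotvC dotvDl !(dotvC z). Qed.

Lemma dotvZr a x y : dotv y (a *: x) = a * dotv y x.
Proof. by rewrite dotvC dotvZl dotvC. Qed.

Lemma dotv0l x : dotv 0 x = 0.
Proof. by rewrite dotvE mul0mx mxE. Qed.

Lemma dotv_ge0 x : 0 <= dotv x x.
Proof. by apply: sumr_ge0 => v _; rewrite -expr2 sqr_ge0. Qed.

Lemma dotv_eq0 x : (dotv x x == 0) = (x == 0).
Proof.
apply/idP/eqP => [|->]; last by rewrite dotv0l.
rewrite psumr_eq0 => [/allP x0|v _]; last by rewrite -expr2 sqr_ge0.
apply/rowP => v; rewrite mxE; apply/eqP.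
by have := x0 v (mem_index_enum v); rewrite /= mulf_eq0 orbb.
Qed.

Lemma dotv_gt0 x : (0 < dotv x x) = (x != 0).
Proof. by rewrite lt_def dotv_ge0 andbT dotv_eq0. Qed.

Lemma dotv_mulmx (A : 'M_n) x y : dotv (x *m A) y = dotv x (y *m A^T).
Proof. by rewrite !dotvE trmx_mul trmxK mulmxA. Qed.

Lemma dotv_diag (u x y : 'rV[R]_n) :
  dotv (x *m diag_mx u) y = \sum_v u 0 v * (x 0 v * y 0 v).
Proof.
by apply: eq_bigr => v _; rewrite mul_mx_diag !mxE mulrAC mulrC mulrA.
Qed.

Lemma dotv_orthonormal p (F : 'M[R]_(p, n)) (a b : 'rV_p) : F *m F^T = 1%:M ->
  dotv (a *m F) (b *m F) = \sum_i a 0 i * b 0 i.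
Proof.
move=> FF1; rewrite dotvE trmx_mul mulmxA -(mulmxA a) FF1 mulmx1 mxE.
by apply: eq_bigr => i _; rewrite mxE.
Qed.

End DotProduct.

(** * The spectral theorem over a real closed field, with eigenvectors as rows *)

Section Spectral.

Variable R : rcfType.

Import complex.

(** Take a complex eigenvector [p + i q] with eigenvalue [x + i y]. Comparing [(p A) . q] with
    [p . (q A)] gives [y (|p|^2 + |q|^2) = 0], so a nonzero one of [p], [q] is a real eigenvector
    for [x]. *)
Lemma symmetric_eigenvector n (A : 'M[R]_n.+1) : A^T = A ->
  exists a (v : 'rV_n.+1), v != 0 /\ v *m A = a *: v.
Proof.
move=> symA; pose A' : 'M[R[i]]_n.+1 := map_mx (real_complex R) A.
have [//|[x y] /eigenvalueP[v vA v0]] := eigenvalue_closed A'.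
pose p := map_mx (@Re R) v; pose q := map_mx (@Im R) v.
have entry i j : v i j = (p i j +i* q i j)%C by rewrite !mxE; case: (v i j).
have mulE (a b c d : R) :
    (a +i* b)%C * (c +i* d)%C = ((a * c - b * d) +i* (a * d + b * c))%C by [].
have vAE j : (v *m A') 0 j = ((p *m A) 0 j +i* (q *m A) 0 j)%C.
  rewrite !mxE; pose f (z : R * R) : R[i] := (z.1 +i* z.2)%C.
  transitivity (f (\sum_i (p 0 i * A i j, q 0 i * A i j))).
    have fD : {morph f : z t / z + t} by [].
    rewrite (big_morph f fD (erefl : f 0 = 0)).
    by apply: eq_bigr => i _; rewrite entry [A' i j]mxE mulE !mulr0 subr0 add0r.
  by rewrite /f !raddf_sum.
have pA : p *m A = x *: p - y *: q.
  apply/rowP => j; have := vAE j; rewrite vA mxE entry mulE => -[E1 E2].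
  rewrite !mxE.
  by move: E1; rewrite !mxE => <-.
have qA : q *m A = x *: q + y *: p.
  apply/rowP => j; have := vAE j; rewrite vA mxE entry mulE => -[E1 E2].
  rewrite !mxE.
  by move: E2; rewrite !mxE => <-.
have y0 : y * (dotv p p + dotv q q) = 0.
  have := dotv_mulmx A p q; rewrite symA pA qA dotvBl dotvDr !dotvZl !dotvZr.
  by move=> /eqP; rewrite -subr_eq0 => /eqP E; rewrite -oppr0 -E; ring.
have [p0|p_neq0] := eqVneq p 0; last first.
  exists x, p; split=> //; rewrite pA; move/eqP: y0.
  rewrite mulf_eq0 => /orP[/eqP->|]; first by rewrite scale0r subr0.
  by rewrite paddr_eq0 ?dotv_ge0 // !dotv_eq0 (negPf p_neq0).
exists x, q; split; last by rewrite qA p0 scaler0 addr0.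
apply: contraNneq v0 => q0; apply/eqP/rowP => j.
by rewrite entry p0 q0 !mxE.
Qed.

(* The reflection exchanging [v] and the first basis vector. *)
Lemma orthogonal_first_row n (v : 'rV[R]_n.+1) : dotv v v = 1 ->
  exists H : 'M_n.+1, [/\ H^T = H, H *m H = 1%:M & delta_mx 0 0 *m H = v].
Proof.
move=> v1; pose e0 : 'rV[R]_n.+1 := delta_mx 0 0; pose w := v - e0.
have dot_e0 x : dotv e0 x = x 0 0.
  rewrite /dotv (bigD1 0) //= big1 ?addr0 ?mxE ?eqxx ?mul1r // => i i0.
  by rewrite mxE (negPf i0) andbF mul0r.
have [w0|w_neq0] := eqVneq w 0.
  exists 1%:M; rewrite trmx1 !mulmx1; split=> //.
  by apply/esym/eqP; rewrite -subr_eq0; apply/eqP.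
have ww : dotv w w = 2 * (1 - v 0 0).
  rewrite dotvBl dot_e0 {1}/w dotvC dotvBl v1 dot_e0 !mxE !eqxx /=; ring.
have ww0 : dotv w w != 0 by rewrite dotv_eq0.
have wwT : w *m w^T = (dotv w w)%:M.
  by rewrite [LHS]mx11_scalar dotvE.
pose H := 1%:M - (2 / dotv w w) *: (w^T *m w).
have HT : H^T = H by rewrite /H linearB /= trmx1 linearZ /= trmx_mul trmxK.
exists H; split=> //; last first.
  rewrite mulmxBr mulmx1 -scalemxAr mulmxA [e0 *m w^T]mx11_scalar -dotvE dot_e0.
  rewrite mul_scalar_mx scalerA.
  have -> : 2 / dotv w w * w 0 0 = -1.
    rewrite !mxE !eqxx /=; apply: (mulfI ww0); rewrite mulrA mulrCA mulfV // mulr1.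
    by rewrite ww; ring.
  by rewrite scaleN1r opprK addrC subrK.
rewrite {1}/H mulmxBl mul1mx -scalemxAl.
have -> : w^T *m w *m H = - (w^T *m w).
  rewrite /H mulmxBr mulmx1 -scalemxAr mulmxA -(mulmxA w^T) wwT.
  rewrite mul_mx_scalar -scalemxAl scalerA divfK // scaler_nat mulr2n.
  by rewrite opprD addrA subrr sub0r.
by rewrite scalerN opprK /H subrK.
Qed.

(** Induction on [n]: the reflection [H] takes the first basis vector to a unit eigenvector, so the
    first row of [H A H] is [a] times that basis vector; by symmetry [H A H] is block diagonal. *)
Theorem symmetric_spectral n (A : 'M[R]_n) : A^T = A ->
  exists (Q : 'M_n) (d : 'rV_n), Q *m Q^T = 1%:M /\ Q *m A = diag_mx d *m Q.
Proof.
elim: n A => [|n IHn] A symA.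
  by exists 1%:M, 0; split; apply/matrixP => - [].
have [a [v0 [v0_neq0 v0A]]] := symmetric_eigenvector symA.
pose v := (Num.sqrt (dotv v0 v0))^-1 *: v0.
have v1 : dotv v v = 1.
  rewrite dotvZl dotvZr mulrA -expr2 exprVn sqr_sqrtr ?dotv_ge0 //.
  by rewrite mulVf // dotv_eq0.
have vA : v *m A = a *: v by rewrite -scalemxAl v0A !scalerA mulrC.
have [H [HT HH e0H]] := orthogonal_first_row v1.
pose B : 'M_(1 + n) := H *m A *m H.
have BT : B^T = B by rewrite /B !trmx_mul HT symA mulmxA.
have B0 j : B 0 j = a * (j == 0)%:R.
  have -> : B 0 j = ((delta_mx 0 0 : 'rV_n.+1) *m B) 0 j.
    by have /rowP/(_ j) := rowE (0 : 'I_n.+1) B; rewrite mxE.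
  by rewrite /B !mulmxA e0H vA -scalemxAl -e0H -mulmxA HH mulmx1 !mxE eqxx.
have Bblock : B = block_mx a%:M 0 0 (drsubmx B).
  have Bur : ursubmx B = 0.
    apply/matrixP => i j; rewrite ord1 mxE mxE.
    rewrite [RHS]mxE (_ : lshift n 0 = 0 :> 'I_(1 + n)); last exact: val_inj.
    by rewrite B0 mulr0.
  rewrite -[LHS]submxK Bur; congr block_mx.
    rewrite [LHS]mx11_scalar mxE mxE (_ : lshift n 0 = 0 :> 'I_(1 + n)).
      by rewrite B0 eqxx mulr1.
    exact: val_inj.
  by rewrite -[dlsubmx B]trmxK trmx_dlsub BT Bur trmx0.
have [|Q1 [d1 [QQ QB]]] := IHn (drsubmx B); first by rewrite trmx_drsub BT.
pose K : 'M_(1 + n) := block_mx 1%:M 0 0 Q1.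
have KK : K *m K^T = 1%:M.
  rewrite /K tr_block_mx !trmx0 trmx1 mulmx_block !mul0mx !mulmx0 mul1mx.
  by rewrite !addr0 !add0r QQ -scalar_mx_block.
have KB : K *m B = diag_mx (row_mx a%:M d1) *m K.
  rewrite Bblock /K diag_mx_row !mulmx_block !mul0mx !mulmx0 mul1mx mulmx1.
  rewrite !addr0 !add0r QB; congr block_mx.
  by apply/matrixP => i j; rewrite !ord1 !mxE.
exists (K *m H), (row_mx a%:M d1); split.
  by rewrite trmx_mul HT mulmxA -(mulmxA K) HH mulmx1.
by rewrite mulmxA -KB /B !mulmxA -(mulmxA _ H H) HH mulmx1.
Qed.

Lemma spectral_permute n (A Q : 'M[R]_n) (d : 'rV_n) (s : 'I_n -> R) :
  Q *m Q^T = 1%:M -> Q *m A = diag_mx d *m Q ->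
  perm_eq [seq s i | i <- enum 'I_n] [seq d 0 i | i <- enum 'I_n] ->
  exists P : 'M_n, P *m P^T = 1%:M /\ P *m A = diag_mx (\row_i s i) *m P.
Proof.
move=> QQ QA sd.
have [p sE] : exists p : 'S_n, forall i, s i = d 0 (p i).
  have /tuple_permP[p] : perm_eq (map_tuple s (ord_tuple n))
      (map_tuple (d 0) (ord_tuple n)) by [].
  move=> E; exists p => i.
  have /(congr1 (fun t => tnth t i)) := val_inj E.
  by rewrite !tnth_map !tnth_ord_tuple.
exists (row_perm p Q); split.
  by rewrite row_permE trmx_mul tr_perm_mx !mulmxA -(mulmxA _ Q) QQ mulmx1
    -perm_mxM mulgV perm_mx1.
rewrite row_permE -mulmxA QA -!row_permE !mul_diag_mx.
by apply/matrixP => i j; rewrite !mxE sE.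
Qed.

Lemma symmetric_spectral_sorted n (A : 'M[R]_n) : A^T = A ->
  exists (Q : 'M_n) (d : 'I_n -> R), [/\ Q *m Q^T = 1%:M,
    Q *m A = diag_mx (\row_i d i) *m Q &
    forall i j : 'I_n, (i <= j)%N -> d i <= d j].
Proof.
move=> /symmetric_spectral[Q [d [QQ QA]]].
pose l := sort <=%R [seq d 0 i | i <- enum 'I_n].
have sl : size l = n by rewrite size_sort size_map size_enum_ord.
pose s (i : 'I_n) := l`_i.
have sE : [seq s i | i <- enum 'I_n] = l.
  by rewrite (map_comp (nth 0 l) val) val_enum_ord -{1}sl map_nth_iota0 ?take_size.
have [|P [PP PA]] := spectral_permute (s := s) QQ QA.
  by rewrite sE perm_sort.
exists P, s; split=> // i j ij; apply: sorted_leq_nth => //; rewrite ?inE ?sl //.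
- exact: le_trans.
- exact: sort_sorted le_total _.
Qed.

Lemma symmetric_spectral_char_poly n (A : 'M[R]_n) (s : 'I_n -> R) :
  A^T = A -> char_poly A = \prod_i ('X - (s i)%:P) ->
  exists Q : 'M_n, Q *m Q^T = 1%:M /\ Q *m A = diag_mx (\row_i s i) *m Q.
Proof.
move=> /symmetric_spectral[Q [d [QQ QA]]] cA.
apply: (spectral_permute QQ QA).
apply: prod_XsubC_eq; rewrite !big_map -!enumT !big_enum /= -cA.
(* [Q] intertwines the two characteristic matrices, and cancelling its nonzero determinant shows
   that [A] and [D] have the same characteristic polynomial. *)
pose QX := map_mx polyC Q; pose D := diag_mx d.
have QXA : QX *m char_poly_mx A = char_poly_mx D *m QX.
  by rewrite mulmxBr mulmxBl -!map_mxM /= QA mul_mx_scalar mul_scalar_mx.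
have detQ : \det QX != 0.
  rewrite det_map_mx polyC_eq0 -unitfE -[_ \is a _]/(Q \in unitmx).
  by case: (mulmx1_unit QQ).
have -> : char_poly A = char_poly D.
  by apply: (mulfI detQ); rewrite -det_mulmx QXA det_mulmx mulrC.
rewrite char_poly_trig; last exact: diag_mx_is_trig.
by apply: eq_bigr => i _; rewrite mxE eqxx.
Qed.

Lemma spectral_form n (A Q : 'M[R]_n) (d : 'rV_n) (b : 'rV_n) :
  Q *m Q^T = 1%:M -> Q *m A = diag_mx d *m Q ->
  dotv (b *m Q *m A) (b *m Q) = \sum_i d 0 i * b 0 i ^+ 2.
Proof.
move=> QQ QA; rewrite -mulmxA QA mulmxA dotv_orthonormal //.
by rewrite -[LHS]/(dotv _ _) dotv_diag.
Qed.

(** The squared norm of [x *m A] is the form of [A A^T] at [x], and [1] plus the sum of the absolute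
    eigenvalues of [A A^T] is a positive bound for all of them. *)
Lemma mulmx_bounded n (A : 'M[R]_n) :
  exists2 K : R, 0 < K & forall x : 'rV_n, dotv (x *m A) (x *m A) <= K * dotv x x.
Proof.
have [|Q [d [QQ QA]]] := @symmetric_spectral n (A *m A^T).
  by rewrite trmx_mul trmxK.
exists (1 + \sum_i `|d 0 i|).
  by rewrite ltr_pwDl // sumr_ge0.
move=> x; have -> : x = x *m Q^T *m Q by rewrite -mulmxA (mulmx1C QQ) mulmx1.
move: (x *m Q^T) => b; rewrite dotv_mulmx dotvC -(mulmxA _ A).
rewrite (spectral_form _ QQ QA) dotv_orthonormal // mulr_sumr.
apply: ler_sum => i _; rewrite -expr2 ler_wpM2r ?sqr_ge0 //.
rewrite (le_trans (ler_norm _)) // (bigD1 i) //= addrCA lerDl.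
by rewrite addr_ge0 // sumr_ge0.
Qed.

End Spectral.

(** * Nodal domains of null vectors *)

Section NodalBound.

Variables (R : realType) (n : nat) (e : rel 'I_n).
Hypothesis e_sym : symmetric e.

Lemma connect_induced_sub (A : {set 'I_n}) u v :
  u \in A -> connect (induced_edge e A) u v -> v \in A.
Proof.
move=> uA uv; rewrite -(@closed_connect _ (induced_edge e A) A _ u v) //.
by move=> x y /and3P[-> ->].
Qed.

Lemma connect_induced_sym (A : {set 'I_n}) : connect_sym (induced_edge e A).
Proof.
by apply: sym_connect_sym => x y; rewrite /induced_edge /= [e y x]e_sym andbCA.
Qed.

(** Recovers a domain from any of its vertices [w], with both signs treated at once through
    [g v * g w > 0]; hence domains sharing a vertex coincide. *)
Lemma strong_nodal_domainE (g : 'I_n -> R) (O : {set 'I_n}) w :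
    O \in strong_nodal_domains e g -> w \in O ->
  O = [set x | connect (induced_edge e [set v | 0 < g v * g w]) w x].
Proof.
have comp (A : {set _}) u : u \in A ->
    w \in [set x | connect (induced_edge e A) u x] ->
    w \in A /\ [set x | connect (induced_edge e A) u x] =
               [set x | connect (induced_edge e A) w x].
  move=> uA; rewrite inE => uw; split; first exact: connect_induced_sub uw.
  by apply/setP => x; rewrite !inE (same_connect (@connect_induced_sym A) uw).
rewrite inE => /orP[] /imsetP[u uA ->] /(comp _ _ uA)[]; rewrite inE => gw ->;
  apply/setP => x; rewrite !inE; congr (connect (induced_edge e _) w x);
  apply/setP => v; rewrite !inE.
  by rewrite pmulr_lgt0.
by rewrite nmulr_lgt0.
Qed.

Lemma strong_nodal_domain_edge (g : 'I_n -> R) (O : {set 'I_n}) u v :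
    O \in strong_nodal_domains e g -> e u v -> 0 < g u * g v ->
  u \in O -> v \in O.
Proof.
move=> OD euv guv uO; rewrite (strong_nodal_domainE OD uO) inE.
apply: connect1; rewrite /induced_edge /= !inE euv [g v * _]mulrC guv -expr2.
rewrite exprn_even_gt0 //= andbT.
by apply: contraTneq guv => ->; rewrite mul0r ltxx.
Qed.

Variables (B : 'M[R]_n) (g : 'I_n -> R).
Hypotheses (B_sym : B^T = B) (B_off : forall u v, u != v -> ~~ e u v -> B u v = 0)
  (B_edge : forall u v, e u v -> B u v <= 0) (g_neq0 : forall v, g v != 0)
  (gB : (\row_v g v) *m B = 0).

(* Duval-Reiner: the form at [c g] is
   [- 1/2 \sum_(u, v) B u v g u g v (c u - c v)^2]. *)
Lemma nodal_form_le0 (c : 'I_n -> R) (x := \row_v (c v * g v)) :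
    (forall u v, e u v -> 0 < g u * g v -> c u = c v) ->
  dotv (x *m B) x <= 0.
Proof.
move=> c_edge.
have BC u v : B u v = B v u by rewrite -[in LHS]B_sym mxE.
have gBE v : \sum_u g u * B u v = 0.
  have /rowP/(_ v) := gB; rewrite !mxE => gBv; rewrite -[RHS]gBv.
  by apply: eq_bigr => u _; rewrite mxE.
have formE : dotv (x *m B) x = \sum_v \sum_u B u v * g u * g v * (c u * c v).
  apply: eq_bigr => v _; rewrite mxE mulr_suml; apply: eq_bigr => u _.
  by rewrite !mxE; ring.
have zero_r : \sum_v \sum_u B u v * g u * g v * c v ^+ 2 = 0.
  apply: big1 => v _; transitivity (g v * c v ^+ 2 * \sum_u g u * B u v).
    by rewrite mulr_sumr; apply: eq_bigr => u _; ring.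
  by rewrite gBE mulr0.
have zero_l : \sum_v \sum_u B u v * g u * g v * c u ^+ 2 = 0.
  rewrite exchange_big -[RHS]zero_r; apply: eq_bigr => u _.
  by apply: eq_bigr => v _; rewrite BC; ring.
have : 0 <= \sum_v \sum_u B u v * g u * g v * (c u - c v) ^+ 2.
  apply: sumr_ge0 => v _; apply: sumr_ge0 => u _.
  have [->|uv] := eqVneq u v; first by rewrite subrr expr0n mulr0.
  have [euv|/(B_off uv)->] := boolP (e u v); last by rewrite !mul0r.
  have [/(c_edge _ _ euv)->|guv] := ltP 0 (g u * g v).
    by rewrite subrr expr0n mulr0.
  by rewrite mulr_ge0 ?sqr_ge0 // -mulrA mulr_le0 ?B_edge.
have -> : \sum_v \sum_u B u v * g u * g v * (c u - c v) ^+ 2 =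
    - dotv (x *m B) x *+ 2; last by rewrite pmulrn_lge0 // oppr_ge0.
rewrite formE mulr2n -opprD; apply/eqP; rewrite -addr_eq0; apply/eqP.
transitivity (\sum_v \sum_u B u v * g u * g v * c v ^+ 2 +
    \sum_v \sum_u B u v * g u * g v * c u ^+ 2); last first.
  by rewrite zero_r zero_l addr0.
rewrite -!big_split /=; apply: eq_bigr => v _.
by rewrite -!big_split /=; apply: eq_bigr => u _; ring.
Qed.

Lemma SND_positive_bound p (U : 'M[R]_(p, n)) :
    (forall x : 'rV_n, (x <= U)%MS -> x != 0 -> 0 < dotv (x *m B) x) ->
  (SND e g + \rank U <= n)%N.
Proof.
move=> U_pos; rewrite /SND; set D := strong_nodal_domains e g.
pose O (i : 'I_#|D|) : {set 'I_n} := enum_val i.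
have OD i : O i \in D := enum_valP i.
(* The rows of [W] are the restrictions of [g] to its domains; since these are disjoint, [c a v] is
   the coefficient of the domain containing [v]. *)
pose W := \matrix_(i < #|D|, v < n) (if v \in O i then g v else 0).
pose c (a : 'rV[R]_#|D|) (v : 'I_n) := \sum_(i | v \in O i) a 0 i.
have WE a : a *m W = \row_v (c a v * g v).
  apply/rowP => v; rewrite !mxE mulr_suml [RHS]big_mkcond /=.
  by apply: eq_bigr => i _; rewrite !mxE; case: ifP; rewrite ?mulr0.
have W_free : row_free W.
  rewrite -kermx_eq0; apply/rowV0P => a /sub_kermxP aW0; apply/rowP => i.
  have [v vi] : exists v, v \in O i.
    have := OD i; rewrite inE => /orP[] /imsetP[v _ ->]; exists v;
      by rewrite inE connect0.
  have: c a v = 0.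
    move/rowP/(_ v): aW0; rewrite WE !mxE => /eqP.
    by rewrite mulf_eq0 (negPf (g_neq0 v)) orbF => /eqP.
  rewrite /c (bigD1 i) //= big1 ?addr0 ?mxE // => j /andP[vj /eqP[]].
  apply: enum_val_inj; rewrite -[LHS]/(O j) -[RHS]/(O i).
  rewrite (strong_nodal_domainE (OD j) vj).
  by rewrite (strong_nodal_domainE (OD i) vi).
(* The form is nonpositive on [W] and positive on nonzero vectors of [U], so the two ranks add up to
   at most [n]. *)
have WU0 : (W :&: U)%MS = 0.
  apply/eqP/rowV0P => x; rewrite sub_capmx => /andP[/submxP[a xE] /U_pos].
  have: dotv (x *m B) x <= 0.
    rewrite xE WE; apply: nodal_form_le0 => u v euv guv; apply: eq_bigl => i.
    apply/idP/idP; apply: (strong_nodal_domain_edge (OD i)) => //.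
      by rewrite e_sym.
    by rewrite mulrC.
  rewrite leNgt => le0 pos; apply/eqP/negPn; apply: contra le0 => /pos.
  by [].
by rewrite -[X in (X + _)%N](eqP W_free) -mxrank_disjoint_sum // rank_leq_col.
Qed.

End NodalBound.

(** * Properties of all sufficiently small positive parameters *)

Section SmallParameter.

Variable R : realFieldType.

Definition small (P : R -> Prop) : Prop :=
  exists2 t0, 0 < t0 & forall t, 0 < t -> t <= t0 -> P t.

Lemma small_and (P Q : R -> Prop) :
  small P -> small Q -> small (fun t => P t /\ Q t).
Proof.
move=> [a a0 Pa] [b b0 Qb]; exists (Num.min a b); first by rewrite lt_min a0.
by move=> t t0; rewrite le_min => /andP[ta tb]; split; [apply: Pa | apply: Qb].
Qed.

Lemma small_forall (I : finType) (P : I -> R -> Prop) :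
  (forall i, small (P i)) -> small (fun t => forall i, P i t).
Proof.
move=> /fin_all_exists2[a a_gt0 Pa]; exists (\big[Num.min/1]_i a i).
  by apply: (big_ind (fun x => 0 < x)) => // x y x0 y0; rewrite lt_min x0.
move=> t t0 ta i; apply: Pa => //; apply: le_trans ta _.
by rewrite (bigD1 i) //= ge_min lexx.
Qed.

Lemma small_imply (b : bool) (P : R -> Prop) :
  (b -> small P) -> small (fun t => b -> P t).
Proof.
case: b => [H|_]; last by exists 1.
by have [a a0 Pa] := H isT; exists a => // t t0 ta _; apply: Pa.
Qed.

Lemma small_lt (a b : R) : 0 < b -> small (fun t => t * a < b).
Proof.
move=> b0; exists (b / (`|a| + 1)) => [|t t0].
  by rewrite divr_gt0 // ltr_wpDl.
rewrite ler_pdivlMr ?ltr_wpDl // => tb; apply: lt_le_trans tb.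
by rewrite ltr_pM2l // (le_lt_trans (ler_norm a)) // ltrDl.
Qed.

Lemma small_witness (P : R -> Prop) : small P -> exists2 t, 0 < t & P t.
Proof. by case=> t t0 Pt; exists t => //; apply: Pt. Qed.

End SmallParameter.

(** * Urschel numbers of null vectors *)

Section UrschelNumber.

Variables (R : realType) (n : nat) (e : rel 'I_n).

Lemma UN_le_SND (f g : 'I_n -> R) : signing f g -> (UN e f <= SND e g)%N.
Proof.
move=> fg; rewrite /UN; case: ex_minnP => s _; apply.
by apply/asboolP; exists g.
Qed.

(** Every signing of [g] is also a signing of [f]. This permits a perturbation to move the zeros of
    [f] freely. *)
Lemma UN_le_UN (f g : 'I_n -> R) :
    (forall v, 0 < f v -> 0 < g v) -> (forall v, f v < 0 -> g v < 0) ->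
  (UN e f <= UN e g)%N.
Proof.
move=> fg_gt0 fg_lt0; rewrite {2}/UN; case: ex_minnP => s + _.
move=> /asboolP[h [[h0 gh_gt0 gh_lt0] <-]]; apply: UN_le_SND; split=> // v.
  by move=> /fg_gt0/gh_gt0.
by move=> /fg_lt0/gh_lt0.
Qed.

Hypotheses (e_simple : simple_graph e) (e_conn : connected_graph e).

Variable (B : 'M[R]_n).
Hypotheses (B_sym : B^T = B) (B_off : forall u v, u != v -> ~~ e u v -> B u v = 0)
  (B_edge : forall u v, e u v -> B u v < 0).

Lemma offdiag_le0 u v : u != v -> B u v <= 0.
Proof.
by move=> uv; have [/B_edge/ltW//|/(B_off uv)->] := boolP (e u v).
Qed.

Lemma crossing_edge (S : {set 'I_n}) : S != set0 -> S != setT ->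
  exists u z, [/\ u \in S, z \notin S & e u z].
Proof.
move=> /set0Pn[u0 u0S] ST.
have [z0 z0S] : exists z, z \notin S.
  by apply/existsP; rewrite -negb_forall; apply: contra ST => /forallP S_all;
    apply/eqP/setP => v; rewrite inE S_all.
have [/existsP[u /existsP[z /and3P[]]]|no_edge] :=
  boolP [exists u, exists z, [&& u \in S, z \notin S & e u z]].
  by exists u, z.
have no_exit u z : e u z -> u \in S -> z \in S.
  move=> euz uS; apply: contraNT no_edge => zS.
  by apply/existsP; exists u; apply/existsP; exists z; apply/and3P.
have S_closed : closed e (mem S).
  move=> u z euz; apply/idP/idP; first exact: no_exit.
  by apply: no_exit; rewrite (proj1 e_simple).
by have := closed_connect S_closed (e_conn u0 z0); rewrite u0S (negPf z0S).
Qed.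

(** Start from the indicator of [N] and enlarge the support along crossing edges. A new vertex [z]
    has a neighbour in the support, so [(h B) z < 0]; a small positive value at [z] keeps this sign
    and does not raise the other entries, as [B] is nonpositive off the diagonal. *)
Lemma positive_supersolution (N : {set 'I_n}) : N != set0 ->
  exists h : 'rV[R]_n, (forall v, 0 < h 0 v) /\
    (forall z, z \notin N -> (h *m B) 0 z <= 0).
Proof.
move=> N0.
pose good (S : {set 'I_n}) := exists h : 'rV[R]_n,
  [/\ forall v, v \in S -> 0 < h 0 v, forall v, v \notin S -> h 0 v = 0 &
      forall z, z \in S -> z \notin N -> (h *m B) 0 z < 0].
suff grow k : exists S : {set 'I_n},
    [/\ N \subset S, good S & S = setT \/ (k <= #|S|)%N].
  have [S [_ [h [h_gt0 _ hB]] S_full]] := grow n.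
  have ST : S = setT.
    by case: S_full => // nS; apply/eqP; rewrite eqEcard subsetT cardsT card_ord.
  exists h; split=> [v|z zN]; first by apply: h_gt0; rewrite ST.
  by apply: ltW; apply: hB => //; rewrite ST.
elim: k => [|k [S [NS [h [h_gt0 h_eq0 hB]] S_full]]].
  exists N; split; [by [] | exists (\row_v (v \in N)%:R) | by right].
  split=> [v|v|z ->//]; rewrite mxE; first by move->.
  by move/negPf->.
have [ST|S_neqT] := eqVneq S setT; first by exists S; split=> //; [exists h|left].
have [|u [z [uS zS euz]]] := crossing_edge _ S_neqT.
  by apply: contraNneq N0 => S0; rewrite -subset0 -S0.
have hB_z : (h *m B) 0 z < 0.
  rewrite mxE (bigD1 u) //= -[ltRHS]addr0 ltr_leD //.
    by rewrite pmulr_rlt0 ?B_edge ?h_gt0.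
  apply: sumr_le0 => w _; have [wS|/h_eq0->] := boolP (w \in S).
    rewrite pmulr_rle0 ?h_gt0 // offdiag_le0 //.
    by apply: contraNneq zS => <-.
  by rewrite mul0r.
have [|t t_gt0 tB] := small_witness (@small_lt R (B z z) (- (h *m B) 0 z) _).
  by rewrite oppr_gt0.
exists (z |: S); split; first by apply: subset_trans NS (subsetUr _ _).
  exists (h + t *: delta_mx 0 z); split=> [v|v|v].
  - rewrite !inE !mxE /= => /orP[/eqP->|vS]; rewrite ?eqxx.
      by rewrite h_eq0 // add0r mulr1.
    by rewrite ltr_wpDr ?h_gt0 // mulr_ge0 // ltW.
  - rewrite !inE !mxE /= => /norP[/negPf-> /h_eq0->].
    by rewrite add0r mulr0.
  - have -> : ((h + t *: delta_mx 0 z) *m B) 0 v = (h *m B) 0 v + t * B z v.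
      rewrite mulmxDl -scalemxAl -rowE [LHS]mxE; congr (_ + _).
      by rewrite !mxE.
    rewrite !inE => /orP[/eqP-> _|vS vN]; first by rewrite addrC -ltrBrDr sub0r.
    rewrite -[ltRHS]addr0 ltr_leD ?hB // pmulr_rle0 // offdiag_le0 //.
    by apply: contraNneq zS => ->.
right; rewrite cardsU1 zS add1n ltnS.
by case: S_full => // ST; rewrite ST eqxx in S_neqT.
Qed.

(* All zeros of [f] receive the sign [+]: the signing is [f + t h] with [h] a
   positive vector satisfying [(h B) z <= 0] at the zeros [z], so that the
   diagonal correction making it a null vector is nonnegative there. *)
Lemma UN_positive_bound p (U : 'M[R]_(p, n)) (b : R) (f : 'rV[R]_n) :
    0 < b -> (forall x : 'rV_n, (x <= U)%MS -> b * dotv x x <= dotv (x *m B) x) ->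
    f != 0 -> f *m B = 0 ->
  (UN e (f 0%R) + \rank U <= n)%N.
Proof.
move=> b_gt0 U_pos f_neq0 fB.
have [|h [h_gt0 hB]] := @positive_supersolution [set v | f 0 v != 0].
  have /rV0Pn[v fv] := f_neq0.
  by apply/set0Pn; exists v; rewrite inE.
have b2_gt0 : 0 < b / 2 by rewrite divr_gt0.
(* The first condition keeps the negative signs of [f]; the other two give [D >= - b / 2] where [f]
   is positive and where it is negative. *)
have small_t : small (fun t => forall v,
    [/\ f 0 v < 0 -> t * h 0 v < - f 0 v,
        0 < f 0 v -> t * (h *m B) 0 v < b / 2 * f 0 v &
        f 0 v < 0 -> t * (b / 2 * h 0 v - (h *m B) 0 v) < b / 2 * - f 0 v]).
  apply: small_forall => v.
  have [||t0 t0_gt0 H] := @small_and _ (fun t => f 0 v < 0 -> t * h 0 v < - f 0 v)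
    (fun t => (0 < f 0 v -> t * (h *m B) 0 v < b / 2 * f 0 v) /\
     (f 0 v < 0 -> t * (b / 2 * h 0 v - (h *m B) 0 v) < b / 2 * - f 0 v)).
  - by apply: small_imply => fv; apply: small_lt; rewrite oppr_gt0.
  - apply: small_and; apply: small_imply => fv; apply: small_lt.
      by rewrite mulr_gt0.
    by rewrite mulr_gt0 // oppr_gt0.
  by exists t0 => // t ? /H[] // ? [? ?]; split.
have [t t_gt0 tP] := small_witness small_t.
pose g v := f 0 v + t * h 0 v.
have g_gt0 v : 0 <= f 0 v -> 0 < g v by move=> fv; rewrite ltr_wpDl ?mulr_gt0.
have g_lt0 v : f 0 v < 0 -> g v < 0.
  by move=> fv; case: (tP v) => /(_ fv) + _ _; rewrite /g; lra.
have g_neq0 v : g v != 0.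
  have [/g_gt0/gt_eqF->//|/g_lt0/lt_eqF->//] := leP 0 (f 0 v).
have fg : signing (f 0) g by split=> // v /ltW; apply: g_gt0.
apply: leq_trans (leq_add (UN_le_SND fg) (leqnn _)) _.
(* Forced by [g (B + D) = 0], because [f B = 0] leaves [g B = t (h B)]. *)
pose D : 'rV[R]_n := \row_v (- (t * (h *m B) 0 v) / g v).
have D_ge v : - (b / 2) <= D 0 v.
  rewrite mxE; have [fv|fv|fv] := ltgtP (f 0 v) 0.
  - have gv := g_lt0 v fv; case: (tP v) => _ _ /(_ fv) tv.
    rewrite ler_ndivlMr // /g; lra.
  - have gv := g_gt0 v (ltW fv); case: (tP v) => _ /(_ fv) tv _.
    rewrite ler_pdivlMr // /g.
    have : 0 <= b / 2 * (t * h 0 v).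
      by apply: mulr_ge0; [|apply: mulr_ge0]; apply: ltW.
    lra.
  - have gv := g_gt0 v; rewrite fv in gv; have {}gv := gv (lexx _).
    apply: (@le_trans _ _ 0); first by rewrite oppr_le0 ltW.
    rewrite mulNr oppr_ge0 -mulrA pmulr_rle0 // pmulr_lle0 ?invr_gt0 //.
    by apply: hB; rewrite inE fv eqxx.
apply: (@SND_positive_bound _ _ e _ (B + diag_mx D)) => //.
- exact: (proj1 e_simple).
- by rewrite linearD /= tr_diag_mx B_sym.
- move=> u v uv euv; rewrite mxE B_off // mxE (negPf uv) addr0 //.
- move=> u v euv; rewrite mxE [diag_mx _ _ _]mxE.
  have /negPf-> : u != v.
    by apply: contraTneq euv => ->; rewrite (proj2 e_simple).
  by rewrite addr0 ltW ?B_edge.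
- have -> : \row_v g v = f + t *: h by apply/rowP => v; rewrite !mxE.
  rewrite mulmxDr mulmxDl fB add0r -scalemxAl; apply/rowP => v.
  rewrite [LHS]mxE mul_mx_diag [X in X + _]mxE [X in _ + X]mxE [D 0 v]mxE.
  rewrite (_ : (f + t *: h) 0 v = g v); last by rewrite !mxE.
  by rewrite mulrCA mulfV // mulr1 subrr mxE.
move=> x xU x0; rewrite mulmxDr dotvDl dotv_diag.
apply: lt_le_trans (lerD (U_pos x xU) (lexx _)).
have xx : 0 < dotv x x by rewrite dotv_gt0.
apply: (@lt_le_trans _ _ (b / 2 * dotv x x)); first by rewrite mulr_gt0.
rewrite -lerBlDl -mulrBl (_ : b / 2 - b = - (b / 2)); last by lra.
rewrite mulr_sumr; apply: ler_sum => v _; rewrite ler_wpM2r ?D_ge //.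
by rewrite -expr2 sqr_ge0.
Qed.

End UrschelNumber.

(** * Perturbation of null vectors *)

Section Perturbation.

Variables (R : realType) (n : nat) (A : 'M[R]_n).
Hypothesis A_sym : A^T = A.

(* In an eigenbasis, [y (A + c 1_Z) = 0] forces
   [\sum_i d i (d i + c) (b i)^2 = 0]; for [c] below the absolute values of the
   negative eigenvalues all terms are nonnegative. *)
Lemma kernel_diagonal_shift : exists2 c : R, 0 < c &
  forall (Z : pred 'I_n) (y : 'rV_n),
    y *m (A + diag_mx (\row_v (if Z v then c else 0))) = 0 -> y *m A = 0.
Proof.
have [Q [d [QQ QA]]] := symmetric_spectral A_sym.
have [|c c_gt0 cd] :=
  @small_witness _ (fun c => forall i, d 0 i < 0 -> c * 1 < - d 0 i).
  apply: small_forall => i; apply: small_imply => di.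
  by apply: small_lt; rewrite oppr_gt0.
exists c => // Z y yA0.
have wE v : (y *m A) 0 v = if Z v then - c * y 0 v else 0.
  move/rowP/(_ v): yA0; rewrite mulmxDr [LHS]mxE mul_mx_diag [X in _ + X]mxE.
  rewrite [(\row__ _) 0 v]mxE [RHS]mxE => /eqP; rewrite addr_eq0 => /eqP->.
  by case: ifP; rewrite ?mulr0 ?oppr0 // mulNr mulrC.
(* Each entry of [y A] is either [0] or [- c] times that of [y], so the sum vanishes term by
   term. *)
have w0 : dotv (y *m A) (y *m A) + c * dotv (y *m A) y = 0.
  rewrite mulr_sumr -big_split /=; apply: big1 => v _; rewrite wE.
  by case: ifP => _; [ring | rewrite !mul0r mulr0 addr0].
have dc i : d 0 i != 0 -> 0 < d 0 i * (d 0 i + c).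
  rewrite neq_lt => /orP[di|di]; last by rewrite mulr_gt0 // addr_gt0.
  by have := cd i di; rewrite mulr1 => dci; rewrite nmulr_rgt0 //; lra.
have yE : y = y *m Q^T *m Q by rewrite -mulmxA (mulmx1C QQ) mulmx1.
move: w0; rewrite yE; move: (y *m Q^T) => b.
rewrite (spectral_form _ QQ QA) -mulmxA QA mulmxA dotv_orthonormal //.
rewrite mulr_sumr -big_split /=.
under eq_bigr => i _.
  rewrite mul_mx_diag mxE.
  rewrite (_ : _ + _ = d 0 i * (d 0 i + c) * b 0 i ^+ 2); last by ring.
over.
move=> /eqP; rewrite psumr_eq0 => [/allP b0|i _]; last first.
  have [->|/dc/ltW di] := eqVneq (d 0 i) 0; first by rewrite !mul0r.
  by rewrite mulr_ge0 ?sqr_ge0.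
suff -> : b *m diag_mx d = 0 by rewrite mul0mx.
apply/rowP => i; have := b0 i (mem_index_enum i).
rewrite mul_mx_diag !mxE /= mulf_eq0 sqrf_eq0 => /orP[|/eqP->]; last first.
  by rewrite mul0r.
have [->|/dc/gt_eqF->//] := eqVneq (d 0 i) 0; by rewrite mulr0.
Qed.

(* [D] is the constant of [kernel_diagonal_shift] on the zeros of [f] and
   [t u f / (f + t h)] elsewhere, where [h] solves the linearized equation. *)
Lemma first_order_perturbation (f u : 'rV[R]_n) (eta : R) :
    f *m A = 0 ->
    (forall x : 'rV_n, x *m A = 0 -> dotv (f *m diag_mx u) x = 0) -> 0 < eta ->
  small (fun t => exists f' D : 'rV_n,
    [/\ f' *m (A + diag_mx D) = 0, forall v, 0 < f 0 v -> 0 < f' 0 v,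
        forall v, f 0 v < 0 -> f' 0 v < 0 &
        forall v, t * (u 0 v - eta) <= D 0 v]).
Proof.
move=> fA fu_ker eta_gt0.
have [c c_gt0 c_ker] := kernel_diagonal_shift.
pose E : 'rV[R]_n := \row_v (if f 0 v == 0 then c else 0).
pose A' := A + diag_mx E.
have E_sym : A'^T = A'.
  by rewrite linearD /= tr_diag_mx A_sym.
(* Fredholm alternative: the right-hand side is orthogonal to the kernel of the symmetric matrix
   [A'], which lies in the kernel of [A]. *)
have [h hE] : exists h, h *m A' = - (f *m diag_mx u).
  suff /submxP[h hE] : (f *m diag_mx u <= A')%MS.
    by exists (- h); rewrite mulNmx hE.
  rewrite submxE; apply/eqP/rowP => j; rewrite [RHS]mxE.
  pose y := row j (cokermx A')^T.
  have yE : y *m A' = 0.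
    by rewrite -row_mul -[X in _ *m X]E_sym -trmx_mul mulmx_coker trmx0 row0.
  rewrite -(fu_ker y) ?dotvE; last exact: c_ker yE.
  by rewrite [LHS]mxE [RHS]mxE; apply: eq_bigr => k _; rewrite !mxE.
(* In order: the lower bound on [D] at zeros of [f], the positivity of [s v] below, and the lower
   bound on [D] at the other vertices. *)
have := @small_forall _ _ (fun v t => [/\ t * (u 0 v - eta) < c,
    f 0 v != 0 -> t * - (h 0 v / f 0 v) < 1 &
    f 0 v != 0 -> t * (h 0 v / f 0 v * (u 0 v - eta)) < eta]).
case=> [v|t0 t0_gt0 t0P].
  have [||t0 t0_gt0 H] := @small_and _ (fun t => t * (u 0 v - eta) < c)
    (fun t => (f 0 v != 0 -> t * - (h 0 v / f 0 v) < 1) /\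
    (f 0 v != 0 -> t * (h 0 v / f 0 v * (u 0 v - eta)) < eta)).
  - exact: small_lt.
  - by apply: small_and; apply: small_imply => _; apply: small_lt.
  by exists t0 => // t tt tt0; have [? [? ?]] := H t tt tt0; split.
exists t0 => // t t_gt0 tt0.
have {t0 t0_gt0 t0P tt0} tP := t0P t t_gt0 tt0.
(* Off the zeros of [f], [s v] is the factor by which the perturbation multiplies [f v]. *)
pose s v := 1 + t * (h 0 v / f 0 v).
have s_gt0 v : f 0 v != 0 -> 0 < s v.
  by move=> fv; case: (tP v) => _ /(_ fv) + _; rewrite /s; lra.
have fs v : f 0 v != 0 -> f 0 v + t * h 0 v = f 0 v * s v.
  by move=> fv; rewrite /s; field.
exists (f + t *: h).
exists (\row_v (if f 0 v == 0 then c else t * u 0 v / s v)).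
split=> [|v fv|v fv|v].
- apply/rowP => v; rewrite mulmxDr mulmxDl fA add0r -scalemxAl.
  rewrite [LHS]mxE mul_mx_diag [X in X + _]mxE [X in _ + X]mxE.
  rewrite [(\row__ _) 0 v]mxE [(f + _) 0 v]mxE [(t *: h) 0 v]mxE [RHS]mxE.
  move/rowP/(_ v): hE; rewrite /A' mulmxDr [LHS]mxE mul_mx_diag [X in _ + X]mxE.
  rewrite [E 0 v]mxE [RHS]mxE mul_mx_diag [in RHS]mxE.
  have [->|fv] := eqVneq (f 0 v) 0.
    rewrite mul0r oppr0 => /eqP; rewrite addr_eq0 => /eqP->; ring.
  rewrite mulr0 addr0 => ->; rewrite fs //.
  by have := s_gt0 v fv => sv; field; rewrite gt_eqF.
- by rewrite !mxE fs ?gt_eqF // mulr_gt0 // s_gt0 ?gt_eqF.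
- by rewrite !mxE fs ?lt_eqF // nmulr_rlt0 // s_gt0 ?lt_eqF.
rewrite mxE; case: eqVneq => [fv|fv]; first by case: (tP v) => /ltW.
rewrite -mulrA ler_pM2l // ler_pdivlMr ?s_gt0 //.
case: (tP v) => _ _ /(_ fv); rewrite /s.
have -> : (u 0 v - eta) * (1 + t * (h 0 v / f 0 v)) =
  u 0 v - eta + t * (h 0 v / f 0 v * (u 0 v - eta)) by ring.
lra.
Qed.

(** For [x = y + z] the form of [A] sees only [y], since [z A = 0] and [A] is symmetric. The
    diagonal term gains a multiple of [t |z|^2] and costs at most [t K' |y|^2], which [a |y|^2]
    absorbs for small [t]. *)
Lemma perturbed_form_positive p q (S : 'M[R]_(p, n)) (Q : 'M[R]_(q, n))
    (u : 'rV[R]_n) (a eta : R) :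
    0 < a -> (forall y : 'rV_n, (y <= S)%MS -> a * dotv y y <= dotv (y *m A) y) ->
    (forall z : 'rV_n, (z <= Q)%MS -> z *m A = 0) -> 0 < eta ->
    (forall z : 'rV_n, (z <= Q)%MS ->
      4 * eta * dotv z z <= dotv (z *m diag_mx u) z) ->
  small (fun t => forall D : 'rV_n, (forall v, t * (u 0 v - eta) <= D 0 v) ->
    exists2 b : R, 0 < b & forall x : 'rV_n, (x <= S + Q)%MS ->
      b * dotv x x <= dotv (x *m (A + diag_mx D)) x).
Proof.
move=> a_gt0 S_pos QA eta_gt0 Q_pos.
pose K := \sum_v `|u 0 v| + eta.
have K_ge v : `|u 0 v - eta| <= K.
  rewrite (le_trans (ler_normB _ _)) // (gtr0_norm eta_gt0) lerD2r.
  rewrite (bigD1 v) //= lerDl.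
  exact: sumr_ge0.
pose K' := K + K ^+ 2 / eta.
(* Completing the square in [eta z + w y]; [K'] is chosen so that the remaining coefficient of
   [y ^+ 2] is nonnegative. Of the margin [4 * eta], [2 * eta] survives. *)
have pointwise v (y z : R) :
    (u 0 v - 2 * eta) * z ^+ 2 - K' * y ^+ 2 <= (u 0 v - eta) * (y + z) ^+ 2.
  have := K_ge v; rewrite ler_norml; set w := u 0 v - eta => /andP[wl wr].
  have -> : u 0 v - 2 * eta = w - eta by rewrite /w; ring.
  rewrite -subr_ge0.
  have -> : w * (y + z) ^+ 2 - ((w - eta) * z ^+ 2 - K' * y ^+ 2) =
      (K + w) * y ^+ 2 + (K - w) * (K + w) / eta * y ^+ 2 +
      (eta * z + w * y) ^+ 2 / eta.
    by rewrite /K'; field; rewrite gt_eqF.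
  have Kw : 0 <= K + w by lra.
  have Kw' : 0 <= K - w by lra.
  have eta_ge0 := ltW eta_gt0.
  have inv_ge0 : 0 <= eta^-1 by rewrite invr_ge0.
  rewrite 2?addr_ge0 //; first exact: mulr_ge0 Kw (sqr_ge0 _).
    exact: mulr_ge0 (mulr_ge0 (mulr_ge0 Kw' Kw) inv_ge0) (sqr_ge0 _).
  exact: mulr_ge0 (sqr_ge0 _) inv_ge0.
have [|t0 t0_gt0 t0P] := @small_lt _ K' (a / 2); first by rewrite divr_gt0.
exists t0 => // t t_gt0 /(t0P t t_gt0) tK D D_ge.
(* The bound [|y + z|^2 <= 2 |y|^2 + 2 |z|^2] doubles these constants to [a / 2] and [2 * eta * t],
   exactly what remains on [y] and on [z]. *)
exists (Num.min (a / 4) (eta * t)).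
  by rewrite lt_min divr_gt0 //= mulr_gt0.
move=> x /sub_addsmxP[[cy cz] /= ->].
set y := cy *m S; set z := cz *m Q; set b := Num.min _ _.
have [yS zQ] : (y <= S)%MS /\ (z <= Q)%MS by rewrite !submxMl.
have yy := dotv_ge0 y; have zz := dotv_ge0 z.
have xx : dotv (y + z) (y + z) <= 2 * dotv y y + 2 * dotv z z.
  rewrite -subr_ge0 (_ : _ - _ = dotv (y - z) (y - z)) ?dotv_ge0 //.
  rewrite -scaleN1r !(dotvDl, dotvDr, dotvZl, dotvZr) (dotvC z y); ring.
have b_ge0 : 0 <= b by apply: ltW; rewrite lt_min divr_gt0 //= mulr_gt0.
have [b1 b2] : b <= a / 4 /\ b <= eta * t by rewrite !ge_min !lexx orbT.
apply: le_trans (ler_wpM2l b_ge0 xx) _.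
have -> : dotv ((y + z) *m (A + diag_mx D)) (y + z) =
    dotv (y *m A) y + dotv ((y + z) *m diag_mx D) (y + z).
  rewrite mulmxDr dotvDl; congr (_ + _); rewrite mulmxDl (QA z zQ) addr0 dotvDr.
  by rewrite (dotv_mulmx A y z) A_sym (QA z zQ) [dotv y 0]dotvC dotv0l addr0.
have D_form : t * (2 * eta * dotv z z - K' * dotv y y) <=
    dotv ((y + z) *m diag_mx D) (y + z).
  rewrite dotv_diag.
  apply: (@le_trans _ _ (t * \sum_v
      ((u 0 v - 2 * eta) * z 0 v ^+ 2 - K' * y 0 v ^+ 2))).
    rewrite ler_pM2l // big_split /= sumrN -!mulr_sumr; apply: lerB; last first.
      by rewrite /dotv; under [X in _ <= _ * X]eq_bigr do rewrite -expr2.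
    have := Q_pos z zQ; rewrite dotv_diag => z_pos.
    rewrite (_ : \sum_v _ = \sum_v u 0 v * (z 0 v * z 0 v) - 2 * eta * dotv z z).
      by move: z_pos; lra.
    rewrite mulr_sumr -sumrB; apply: eq_bigr => v _; ring.
  rewrite mulr_sumr; apply: ler_sum => v _; rewrite [(y + z) 0 v]mxE -expr2.
  apply: (@le_trans _ _ (t * ((u 0 v - eta) * (y 0 v + z 0 v) ^+ 2))).
    by rewrite ler_pM2l.
  by rewrite mulrA ler_wpM2r ?sqr_ge0.
have := S_pos y yS.
have : (t * K') * dotv y y <= a / 2 * dotv y y by rewrite ler_wpM2r // ltW.
have : b * dotv y y <= a / 4 * dotv y y by rewrite ler_wpM2r.
have : b * dotv z z <= eta * t * dotv z z by rewrite ler_wpM2r.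
move: D_form; lra.
Qed.

End Perturbation.

(** At one small [t], the null vector [f'] of [A + D] keeps the nonzero signs of [f] while [A + D]
    is positive on [S + Q]. The sum is direct because the form of [A] is positive on [S] and zero on
    [Q]. *)
Lemma UN_perturbation_bound (R : realType) n (e : rel 'I_n) (A : 'M[R]_n)
    p q (S : 'M[R]_(p, n)) (Q : 'M[R]_(q, n)) (f u : 'rV[R]_n) (a b : R) :
    simple_graph e -> connected_graph e -> A^T = A ->
    (forall v w, v != w -> ~~ e v w -> A v w = 0) ->
    (forall v w, e v w -> A v w < 0) ->
    f != 0 -> f *m A = 0 ->
    (forall x : 'rV_n, x *m A = 0 -> dotv (f *m diag_mx u) x = 0) ->
    0 < a -> (forall y : 'rV_n, (y <= S)%MS -> a * dotv y y <= dotv (y *m A) y) ->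
    (forall z : 'rV_n, (z <= Q)%MS -> z *m A = 0) -> 0 < b ->
    (forall z : 'rV_n, (z <= Q)%MS -> b * dotv z z <= dotv (z *m diag_mx u) z) ->
  (UN e (f 0%R) + \rank S + \rank Q <= n)%N.
Proof.
move=> e_simple e_conn A_sym A_off A_edge f0 fA fu a_gt0 S_pos QA b_gt0 Q_pos.
have eta_gt0 : 0 < b / 4 by rewrite divr_gt0.
have Q_pos' (z : 'rV_n) : (z <= Q)%MS ->
    4 * (b / 4) * dotv z z <= dotv (z *m diag_mx u) z.
  by move/Q_pos; rewrite (_ : 4 * (b / 4) = b) //; field.
have /small_witness[t t_gt0 [[f' [D [f'B f_gt0 f_lt0 D_ge]]] B_pos]] :=
  small_and (first_order_perturbation A_sym fA fu eta_gt0)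
    (perturbed_form_positive A_sym a_gt0 S_pos QA eta_gt0 Q_pos').
have {B_pos} [g g_gt0 B_pos] := B_pos D D_ge.
have SQ0 : (S :&: Q)%MS = 0.
  apply/eqP/rowV0P => x; rewrite sub_capmx => /andP[/S_pos + /QA xA].
  rewrite xA dotv0l pmulr_rle0 // => xx.
  by apply/eqP; rewrite -dotv_eq0 eq_le xx dotv_ge0.
rewrite -addnA -mxrank_disjoint_sum //.
apply: leq_trans (leq_add (UN_le_UN e f_gt0 f_lt0) (leqnn _)) _.
apply: (UN_positive_bound (B := A + diag_mx D) e_simple e_conn _ _ _ g_gt0) => //.
- by rewrite linearD /= tr_diag_mx A_sym.
- by move=> v w vw evw; rewrite mxE A_off // mxE (negPf vw) addr0.
- move=> v w evw; rewrite mxE [diag_mx _ _ _]mxE.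
  have /negPf-> : v != w.
    by apply: contraTneq evw => ->; rewrite (proj2 e_simple).
  by rewrite addr0 A_edge.
have /rV0Pn[v fv] := f0; apply/eqP => /rowP/(_ v); rewrite mxE => f'v.
move: fv (f_gt0 v) (f_lt0 v); rewrite f'v ltxx.
by rewrite neq_lt => /orP[fv _ /(_ fv)|fv /(_ fv)].
Qed.

(** * Diagonal matrices whose compression has simple spectrum *)

Section DistinctSpectrum.

Variable R : rcfType.

(** These are at most [m - 1] linear conditions on [m] unknowns: [C] collects them as columns, and
    its zero column [i] makes it singular. *)
Lemma vanishing_combination m (X : 'M[R]_m) (i : 'I_m) (p : pred 'I_m) :
  exists b : 'rV_m, [/\ b != 0, forall l, l != i -> p l -> b 0 l = 0 &
    forall l, l != i -> ~~ p l -> (b *m X) 0 l = 0].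
Proof.
pose C := \matrix_(r, l)
  (if l == i then 0 else if p l then (1%:M : 'M_m) r l else X r l).
have /det0P[b b0 bC] : \det C == 0.
  rewrite (expand_det_col C i) big1 // => r _.
  by rewrite mxE eqxx mul0r.
exists b; split=> // l /negPf li pl; move/rowP/(_ l): bC;
  rewrite [RHS]mxE => bCl; last first.
  rewrite -[RHS]bCl [LHS]mxE [RHS]mxE; apply: eq_bigr => r _.
  by rewrite [C r l]mxE li (negPf pl).
rewrite -[b]mulmx1 -[RHS]bCl [LHS]mxE [RHS]mxE; apply: eq_bigr => r _.
by rewrite [C r l]mxE li pl.
Qed.

(* For rapidly growing [s], the i-th eigenvalue of [T diag(s) T^T] is comparable
   to [s i], by the Courant-Fischer comparison of the flag of the first
   eigenvectors with that of the coordinates. *)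
Lemma congruent_diagonal_distinct_spectrum m (T : 'M[R]_m) : T \in unitmx ->
  exists (s : 'rV_m) (Q : 'M_m) (d : 'I_m -> R), [/\ Q *m Q^T = 1%:M,
    Q *m (T *m diag_mx s *m T^T) = diag_mx (\row_i d i) *m Q &
    forall i j : 'I_m, (i < j)%N -> d i < d j].
Proof.
move=> T_unit.
have [K1 K1_gt0 K1P] := mulmx_bounded T.
have [K2 K2_gt0 K2P] := mulmx_bounded (invmx T).
(* With ratio above [K1 * K2], the intervals from [s i / K2] to [K1 * s i], which will contain the
   [d i], are disjoint and increasing. *)
pose rho := K1 * K2 + 1; have rho_ge1 : 1 <= rho by rewrite lerDr ltW ?mulr_gt0.
pose s : 'rV[R]_m := \row_i rho ^+ i.
have s_gt0 i : 0 < s 0 i by rewrite mxE exprn_gt0 // (lt_le_trans ltr01).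
have s_le (i j : 'I_m) : (i <= j)%N -> s 0 i <= s 0 j.
  by move=> ij; rewrite !mxE ler_weXn2l.
have s_lt (i j : 'I_m) : (i < j)%N -> K1 * K2 * s 0 i < s 0 j.
  move=> ij; apply: (@lt_le_trans _ _ (rho * s 0 i)).
    by rewrite ltr_pM2r // ltrDl.
  by rewrite !mxE -exprS ler_weXn2l.
pose C := T *m diag_mx s *m T^T.
have C_sym : C^T = C by rewrite !trmx_mul trmxK tr_diag_mx mulmxA.
have [Q [d [QQ QC d_le]]] := symmetric_spectral_sorted C_sym.
have formE (b : 'rV_m) :
    \sum_l d l * b 0 l ^+ 2 = \sum_l s 0 l * (b *m (Q *m T)) 0 l ^+ 2.
  transitivity (dotv (b *m Q *m C) (b *m Q)).
    by rewrite (spectral_form _ QQ QC); apply: eq_bigr => l _; rewrite mxE.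
  by rewrite /C !mulmxA dotv_mulmx trmxK dotv_diag.
have normE (b : 'rV_m) : dotv (b *m Q) (b *m Q) = dotv b b.
  by rewrite dotv_orthonormal.
(* Test vector in the span of the eigenvectors from [i] on, with its image under [T] supported on
   the coordinates up to [i]. *)
have d_upper i : d i <= K1 * s 0 i.
  have [b [b0 b_lo b_hi]] := vanishing_combination (Q *m T) i (fun l => l < i)%N.
  have bb : 0 < dotv b b by rewrite dotv_gt0.
  rewrite -(ler_pM2r bb).
  apply: (@le_trans _ _ (\sum_l d l * b 0 l ^+ 2)).
    rewrite mulr_sumr; apply: ler_sum => l _; rewrite -expr2.
    have [->//|li] := eqVneq l i; have [lti|lei] := ltnP l i.
      by rewrite (b_lo l li lti) expr0n !mulr0.
    by rewrite ler_wpM2r ?sqr_ge0 ?d_le.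
  rewrite formE; apply: (@le_trans _ _ (s 0 i * dotv (b *m Q *m T) (b *m Q *m T))).
    rewrite mulr_sumr -mulmxA; apply: ler_sum => l _; rewrite -expr2.
    have [->//|li] := eqVneq l i; have [lti|lei] := ltnP l i.
      by rewrite ler_wpM2r ?sqr_ge0 // s_le // ltnW.
    by rewrite (b_hi l li) -?leqNgt // expr0n !mulr0.
  by rewrite [K1 * _]mulrC -mulrA ler_pM2l // -(normE b) K1P.
(* The same comparison with the two flags reversed; [invmx T] bounds the norm of [b] by that of its
   image. *)
have d_lower i : s 0 i <= K2 * d i.
  have [b [b0 b_hi b_lo]] := vanishing_combination (Q *m T) i (fun l => i < l)%N.
  have bb : 0 < dotv b b by rewrite dotv_gt0.
  rewrite -(ler_pM2r bb).
  have bT : dotv b b <= K2 * dotv (b *m Q *m T) (b *m Q *m T).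
    by rewrite -normE -{1 2}(mulmxK T_unit (b *m Q)) K2P.
  apply: (@le_trans _ _ (K2 * (s 0 i * dotv (b *m Q *m T) (b *m Q *m T)))).
    by rewrite mulrCA ler_pM2l.
  rewrite -[leRHS]mulrA ler_pM2l //.
  apply: (@le_trans _ _ (\sum_l s 0 l * (b *m (Q *m T)) 0 l ^+ 2)).
    rewrite mulr_sumr -mulmxA; apply: ler_sum => l _; rewrite -expr2.
    have [->//|li] := eqVneq l i; have [lti|lei] := ltnP i l.
      by rewrite ler_wpM2r ?sqr_ge0 // s_le // ltnW.
    by rewrite (b_lo l li) -?leqNgt // expr0n !mulr0.
  rewrite -formE mulr_sumr; apply: ler_sum => l _; rewrite -expr2.
  have [->//|li] := eqVneq l i; have [lti|lei] := ltnP i l.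
    by rewrite (b_hi l li lti) expr0n !mulr0.
  by rewrite ler_wpM2r ?sqr_ge0 ?d_le.
exists s, Q, d; split=> // i j ij.
rewrite -(ltr_pM2l K2_gt0).
apply: le_lt_trans (lt_le_trans (s_lt i j ij) (d_lower j)).
by rewrite [K1 * _]mulrC -mulrA ler_pM2l.
Qed.

(** Choose [m] columns of [F0] forming an invertible [T] and put weights [s] on those coordinates,
    zero elsewhere. The compression to [F0] is then [T diag(s) T^T], and rotating [F0] by its
    eigenvectors preserves the row space. *)
Lemma diagonal_distinct_compression m n (F0 : 'M[R]_(m, n)) :
    F0 *m F0^T = 1%:M ->
  exists (u : 'rV[R]_n) (F : 'M[R]_(m, n)) (d : 'I_m -> R),
    [/\ F *m F^T = 1%:M, (F == F0)%MS,
        F *m diag_mx u *m F^T = diag_mx (\row_i d i) &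
        forall i j : 'I_m, (i < j)%N -> d i < d j].
Proof.
move=> F0F0.
have F0_full : row_full F0^T.
  rewrite /row_full mxrank_tr -/(row_free F0); apply/row_freeP.
  by exists F0^T.
pose p := fullrankfun F0_full.
pose T := (rowsub p F0^T)^T.
have T_unit : T \in unitmx by rewrite unitmx_tr fullrowsub_unit.
have [s [Q [d [QQ QC d_lt]]]] := congruent_diagonal_distinct_spectrum T_unit.
pose u : 'rV[R]_n := \row_v \sum_(l | p l == v) s 0 l.
have uE : F0 *m diag_mx u *m F0^T = T *m diag_mx s *m T^T.
  rewrite !mul_mx_diag; apply/matrixP => i j; rewrite [LHS]mxE [RHS]mxE.
  rewrite [RHS](partition_big p predT) //=; apply: eq_bigr => v _.
  rewrite !mxE mulr_sumr mulr_suml; apply: eq_bigr => l /eqP <-.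
  by rewrite !mxE.
have QtQ := mulmx1C QQ.
exists u, (Q *m F0), d; split=> //.
- by rewrite trmx_mul mulmxA -(mulmxA Q) F0F0 mulmx1.
- apply/andP; split; first exact: submxMl.
  by rewrite -[X in (X <= _)%MS]mul1mx -QtQ -mulmxA submxMl.
transitivity (Q *m (F0 *m diag_mx u *m F0^T) *m Q^T).
  by rewrite trmx_mul !mulmxA.
by rewrite uE QC -mulmxA QQ mulmx1.
Qed.

End DistinctSpectrum.

(** * Orthonormal rows and compressed forms *)

Section OrthonormalRows.

Variable R : realFieldType.

Lemma rowsub_orthonormal m n p (F : 'M[R]_(m, n)) (g : 'I_p -> 'I_m) :
  injective g -> F *m F^T = 1%:M -> rowsub g F *m (rowsub g F)^T = 1%:M.
Proof.
move=> g_inj FF; apply/matrixP => i j.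
have /matrixP/(_ (g i) (g j)) := FF; rewrite !mxE (inj_eq g_inj) => <-.
by apply: eq_bigr => v _; rewrite !mxE.
Qed.

Lemma orthonormal_rank p n (F : 'M[R]_(p, n)) :
  F *m F^T = 1%:M -> \rank F = p.
Proof. by move=> FF; apply/eqP/row_freeP; exists F^T. Qed.

Lemma dotv_compression p n (F : 'M[R]_(p, n)) (u : 'rV_n) (d : 'I_p -> R)
    (a b : 'rV_p) :
  F *m diag_mx u *m F^T = diag_mx (\row_i d i) ->
  dotv (a *m F *m diag_mx u) (b *m F) = \sum_i d i * (a 0 i * b 0 i).
Proof.
move=> FuF; rewrite dotvE trmx_mul.
transitivity ((a *m (F *m diag_mx u *m F^T) *m b^T) 0 0).
  by rewrite !mulmxA.
rewrite FuF -dotvE dotv_diag; apply: eq_bigr => i _.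
by rewrite mxE.
Qed.

End OrthonormalRows.

(** First-order direction [s (u - d j)]: its compression to the kernel is diagonal with [j]-th entry
    [0], so row [j] is orthogonal to the kernel for it, and it is positive on the rows selected by
    [g]. The sign of [s] decides whether indices above or below [j] qualify. *)
Lemma UN_compression_bound (R : realType) n (e : rel 'I_n) (A : 'M[R]_n)
    m p q (S : 'M[R]_(p, n)) (F : 'M[R]_(m, n)) (u : 'rV[R]_n) (d : 'I_m -> R)
    (g : 'I_q -> 'I_m) (a s : R) (j : 'I_m) :
    simple_graph e -> connected_graph e -> A^T = A ->
    (forall v w, v != w -> ~~ e v w -> A v w = 0) ->
    (forall v w, e v w -> A v w < 0) ->
    S *m S^T = 1%:M -> 0 < a ->
    (forall y : 'rV_n, (y <= S)%MS -> a * dotv y y <= dotv (y *m A) y) ->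
    F *m F^T = 1%:M -> (forall x : 'rV_n, (x <= F)%MS <-> x *m A = 0) ->
    F *m diag_mx u *m F^T = diag_mx (\row_i d i) ->
    injective g -> (forall i, 0 < s * (d (g i) - d j)) ->
  (UN e (F j) + p + q <= n)%N.
Proof.
move=> e_simple e_conn A_sym A_off A_edge SS a_gt0 S_pos FF FA FuF g_inj s_gt0.
pose G := rowsub g F.
have GG : G *m G^T = 1%:M by apply: rowsub_orthonormal.
have GF : (G <= F)%MS by apply: rowsub_sub.
have GuG : G *m diag_mx u *m G^T = diag_mx (\row_i d (g i)).
  apply/matrixP => i l; have /matrixP/(_ (g i) (g l)) := FuF.
  rewrite !mul_mx_diag !mxE (inj_eq g_inj) => <-.
  by apply: eq_bigr => v _; rewrite !mxE.
pose f := row j F; pose u' := s *: (u - const_mx (d j)).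
have fE : f = delta_mx 0 j *m F by rewrite -rowE.
have u'E x y : dotv (x *m diag_mx u') y =
    s * (dotv (x *m diag_mx u) y - d j * dotv x y).
  rewrite !dotv_diag mulr_sumr -sumrB mulr_sumr; apply: eq_bigr => v _.
  by rewrite !mxE; ring.
have [|b b_gt0 bP] :=
  @small_witness _ (fun b => forall i, b * 1 < s * (d (g i) - d j)).
  by apply: small_forall => i; apply: small_lt.
rewrite -{1}(orthonormal_rank SS) -{1}(orthonormal_rank GG).
apply: (@leq_trans (UN e (f 0%R) + \rank S + \rank G)).
  rewrite !leq_add2r; apply: UN_le_UN => v; by rewrite [f 0 v]mxE.
apply: (UN_perturbation_bound (u := u') e_simple e_conn A_sym A_off A_edge
  _ _ _ a_gt0 S_pos _ b_gt0 _).
- apply/eqP => f0; have /matrixP/(_ j j)/eqP := FF.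
  rewrite !mxE eqxx big1 ?(eq_sym 0) ?oner_eq0 // => v _.
  by have /rowP/(_ v) := f0; rewrite !mxE => ->; rewrite mul0r.
- by apply/FA; rewrite fE submxMl.
- move=> x /FA/submxP[c ->]; rewrite u'E fE (dotv_compression _ _ FuF).
  rewrite dotv_orthonormal // mulr_sumr -sumrB big1 ?mulr0 // => i _.
  have [->|ij] := eqVneq i j; first by rewrite subrr.
  by rewrite mxE (negPf ij) andbF !mul0r !mulr0 subrr.
- by move=> z zG; apply/FA; apply: submx_trans zG GF.
move=> z /submxP[c ->]; rewrite u'E (dotv_compression _ _ GuG).
rewrite dotv_orthonormal // !mulr_sumr -sumrB mulr_sumr; apply: ler_sum => i _.
have -> : s * (d (g i) * (c 0 i * c 0 i) - d j * (c 0 i * c 0 i)) =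
  s * (d (g i) - d j) * (c 0 i * c 0 i) by ring.
by rewrite ler_wpM2r -?expr2 ?sqr_ge0 // -[b]mulr1 ltW.
Qed.

(** * The eigenbasis and the two bounds *)

Lemma shifted_ordinals b p n : (b + p <= n)%N ->
  exists2 g : 'I_p -> 'I_n, injective g & forall i, g i = (b + i)%N :> nat.
Proof.
move=> bpn.
have g_lt (i : 'I_p) : (b + i < n)%N.
  by apply: leq_trans bpn; rewrite ltn_add2l.
exists (fun i => Ordinal (g_lt i)) => // i j [/addnI ij].
exact: val_inj.
Qed.

Theorem theorem2p12 (R : realType) (n : nat) (e : rel 'I_n)
    (M : 'M[R]_n) (lam : nat -> R) (k m : nat) :
  simple_graph e ->
  connected_graph e ->
  generalized_laplacian e M ->
  ordered_spectrum M lam ->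
  eigenvalue_block n lam k m ->
  exists F : 'M[R]_(m, n),
    orthonormal_basis F (eigenspace M (lam k)) /\
    (forall j : 'I_m, (UN e (F j) <= k + minn j (m - 1 - j))%N).
Proof.
move=> e_simple e_conn [M_sym M_off M_edge] [M_char lam_le].
case=> /and3P[k_gt0 m_gt0 km_le] lam_lt lam_eq lam_gt.
(* Rows of [Q] are numbered from [0] and eigenvalues from [1], so row [i] belongs to [lam i.+1]. *)
have [||Q [QQ QM]] := @symmetric_spectral_char_poly _ _ M (fun i => lam i.+1).
- by [].
- by rewrite M_char big_add1 /= big_mkord.
have [|gE gE_inj gEE] := @shifted_ordinals (k - 1) m n; first by lia.
have [|gS gS_inj gSE] := @shifted_ordinals (k + m - 1) (n - (k + m - 1)) n.
  by lia.
(* [F0] holds the eigenvectors of [lam k], ..., [lam (k + m - 1)], and [S] those of [lam (k + m)],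
   ..., [lam n]. *)
pose F0 := rowsub gE Q; pose S := rowsub gS Q.
have rowsubM p (g : 'I_p -> 'I_n) :
    rowsub g Q *m M = diag_mx (\row_i lam (g i).+1) *m rowsub g Q.
  rewrite mul_rowsub_mx QM !mul_diag_mx.
  by apply/matrixP => i v; rewrite !mxE.
have F0_eigen : (F0 <= eigenspace M (lam k))%MS.
  apply/eigenspaceP; rewrite rowsubM mul_diag_mx; apply/matrixP => i v.
  rewrite !mxE gEE (_ : (k - 1 + i).+1 = k + i)%N ?lam_eq //.
  by lia.
have eigen_F0 : (eigenspace M (lam k) <= F0)%MS.
  apply/rV_subP => x /eigenspaceP xM.
  have xE : x = x *m Q^T *m Q by rewrite -mulmxA (mulmx1C QQ) mulmx1.
  (* A nonzero coordinate forces [lam i.+1 = lam k], and the strict gaps at both ends then place [i]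
     in the block. *)
  have bE i : (x *m Q^T) 0 i * (lam i.+1 - lam k) = 0.
    have : x *m Q^T *m diag_mx (\row_i lam i.+1) = lam k *: (x *m Q^T).
      rewrite scalemxAl -xM {2}xE -(mulmxA _ Q M) QM mulmxA.
      by rewrite -[RHS]mulmxA QQ mulmx1.
    move/rowP/(_ i); rewrite mul_mx_diag !mxE => E.
    by rewrite mulrBr E mulrC subrr.
  rewrite xE mulmx_sum_row; apply: summx_sub => i _.
  have /eqP := bE i; rewrite mulf_eq0 => /orP[/eqP->|].
    by rewrite scale0r sub0mx.
  rewrite subr_eq0 => /eqP lam_i; apply: scalemx_sub.
  have ki : (k <= i.+1)%N.
    rewrite leqNgt; apply/negP => ik.
    have : lam i.+1 <= lam (k - 1)%N by apply: lam_le; lia.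
    by rewrite leNgt lam_i lam_lt //; lia.
  have im : (i.+1 < k + m)%N.
    rewrite ltnNge; apply/negP => kmi.
    have : lam (k + m)%N <= lam i.+1 by apply: lam_le => //; lia.
    rewrite leNgt lam_i -(lam_eq (m - 1)%N); last by lia.
    rewrite addnBA // lam_gt //; have := ltn_ord i; lia.
  have im' : (i.+1 - k < m)%N by lia.
  have <- : gE (Ordinal im') = i by apply: val_inj; rewrite /= gEE /=; lia.
  by rewrite -row_rowsub row_sub.
have [u [F [d [FF FF0 FuF d_lt]]]] :=
  diagonal_distinct_compression (rowsub_orthonormal gE_inj QQ).
have F_eigen : (F == eigenspace M (lam k))%MS.
  by apply/eqmxP/(eqmx_trans (eqmxP FF0))/eqmxP; rewrite F0_eigen.
exists F; split.
  split=> //; last by apply/row_freeP; exists F^T.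
  move=> i j; have /matrixP/(_ i j) := FF; rewrite !mxE => <-.
  by apply: eq_bigr => v _; rewrite mxE.
move=> j; pose A := M - (lam k)%:M.
have A_off v w : v != w -> A v w = M v w.
  by move=> /negPf vw; rewrite !mxE vw subr0.
have FA (x : 'rV_n) : (x <= F)%MS <-> x *m A = 0.
  rewrite (eqmxP F_eigen); split=> [/eigenspaceP xM|xA].
    by rewrite mulmxBr xM mul_mx_scalar subrr.
  by apply/eigenspaceP/eqP; rewrite -subr_eq0 -mul_mx_scalar -mulmxBr; apply/eqP.
(* The spectral gap above [lam k]; when there is no larger eigenvalue, [S] has no rows and [1] is a
   default. *)
pose a := if (k + m <= n)%N then lam (k + m)%N - lam k else 1.
have a_gt0 : 0 < a.
  rewrite /a; case: ifP => // kmn; rewrite subr_gt0 -(lam_eq (m - 1)%N); last by lia.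
  by rewrite addnBA // lam_gt.
have S_pos (y : 'rV_n) : (y <= S)%MS -> a * dotv y y <= dotv (y *m A) y.
  move=> /submxP[c ->].
  have SS := rowsub_orthonormal gS_inj QQ.
  rewrite mulmxBr dotvBl -mulmxA rowsubM mulmxA mul_mx_scalar dotvZl.
  rewrite !dotv_orthonormal // !mulr_sumr -sumrB; apply: ler_sum => i _.
  rewrite mul_mx_diag !mxE.
  have -> : c 0 i * lam (gS i).+1 * c 0 i - lam k * (c 0 i * c 0 i) =
    (lam (gS i).+1 - lam k) * (c 0 i * c 0 i) by ring.
  rewrite ler_wpM2r -?expr2 ?sqr_ge0 // /a gSE.
  have kmn : (k + m <= n)%N by have := ltn_ord i; lia.
  by rewrite kmn lerB // lam_le //; have := ltn_ord i; lia.
have bound q (g : 'I_q -> 'I_m) s : injective g ->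
    (forall i, 0 < s * (d (g i) - d j)) ->
    (UN e (F j) + (n - (k + m - 1)) + q <= n)%N.
  move=> g_inj s_gt0.
  apply: (UN_compression_bound e_simple e_conn _ _ _ (rowsub_orthonormal gS_inj QQ)
    a_gt0 S_pos FF FA FuF g_inj s_gt0).
  - by rewrite linearB /= M_sym tr_scalar_mx.
  - by move=> v w vw evw; rewrite A_off ?M_off.
  - move=> v w evw; rewrite A_off ?M_edge //.
    by apply: contraTneq evw => ->; rewrite (proj2 e_simple).
have jm := ltn_ord j.
rewrite addn_minr leq_min; apply/andP; split.
  (* The [m - 1 - j] indices above [j], with sign [1], give the bound [k + j]. *)
  have [|g g_inj gE'] := @shifted_ordinals j.+1 (m - 1 - j) m; first by lia.
  have : (UN e (F j) + (n - (k + m - 1)) + (m - 1 - j) <= n)%N.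
    by apply: (bound _ g 1) => // i; rewrite mul1r subr_gt0 d_lt // gE'; lia.
  by move: (UN e (F j)) => N; lia.
(* The [j] indices below [j], with sign [-1], give [k + (m - 1 - j)] for the same row. *)
have [|g g_inj gE'] := @shifted_ordinals 0 j m; first by lia.
have : (UN e (F j) + (n - (k + m - 1)) + j <= n)%N.
  apply: (bound _ g (-1)) => // i; rewrite mulN1r opprB subr_gt0 d_lt //.
  by rewrite gE' add0n.
by move: (UN e (F j)) => N; lia.
Qed.
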